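(* Let $\mu$ be a probability measure on $\mathbb{Z}$ supported on a finite set of at least two elements. Let $p$ be a prime, $a\in\mathbb{F}_p$ and $\theta\in(0,\sqrt{\log p}/2)$. If $n\ge0$ is the integer part of $(\log p-\theta\sqrt{\log p})/H(\mu)$, then $$\|\mu_a^{(n)}-u\|_{TV}\ge 1-e^{-\theta^2}-2e^{-\frac{H(\mu)}{C_\mu^2}\theta^2}.$$
   Context: Here $u$ is the uniform probability measure on $\mathbb{F}_p$, and $\mu_a^{(n)}$ is the law of $x_n$, where $x_0=0$ and $x_{k+1}=ax_k+b_k$ in $\mathbb{F}_p$, the $b_k$ being the reductions mod $p$ of independent integer-valued random variables with common law $\mu$. The total variation distance is $\|\pi_1-\pi_2\|_{TV}=\sup_{A\subset\mathbb{F}_p}|\pi_1(A)-\pi_2(A)|$. The entropy of $\mu$ is $H(\mu)=\sum_{z\in\mathbb{Z}}\mu(z)\log\frac1{\mu(z)}$, and $C_\mu=\max\{1,\log(\sup\mu/\inf\mu)\}$, where $\sup$ and $\inf$ of $z\mapsto\mu(z)$ are taken over the support of $\mu$. *)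

(* Defs.v *)
From HB Require Import structures.
From mathcomp Require Import all_boot all_order all_algebra.
From mathcomp Require Import finmap.
From mathcomp Require Import all_classical all_reals all_analysis.

Set Implicit Arguments.
Unset Strict Implicit.
Unset Printing Implicit Defensive.

Import Order.TTheory GRing.Theory Num.Theory.
Import numFieldNormedType.Exports.

Local Open Scope classical_set_scope.
Local Open Scope ring_scope.

(* Every subset of int and of 'I_n.+1 is measurable; the second instance covers
   'F_p, whose carrier is an ordinal type 'I_m.+2. *)
HB.instance Definition _ := isPointed.Build int 0.
HB.instance Definition _ := @isMeasurable.Build default_measure_display
  int discrete_measurable discrete_measurable0
  discrete_measurableC discrete_measurableU.

HB.instance Definition _ (n : nat) := isPointed.Build 'I_n.+1 ord0.
HB.instance Definition _ (n : nat) := @isMeasurable.Build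
  default_measure_display 'I_n.+1 discrete_measurable discrete_measurable0
  discrete_measurableC discrete_measurableU.

Definition mass (R : realType) (mu : probability int R) (z : int) : R :=
  fine (mu [set z]).

Definition mass_support (R : realType) (mu : probability int R) : set int :=
  [set z | mass mu z != 0].

(* A finitely supported sum, so meaningful only if mass_support mu is finite.
   Points outside the support contribute 0 * ln 0^-1 = 0. *)
Definition entropy (R : realType) (mu : probability int R) : R :=
  \sum_(z \in [set: int]) mass mu z * ln (mass mu z)^-1.

Definition Cmu (R : realType) (mu : probability int R) : R :=
  Num.max 1 (ln (sup (mass mu @` mass_support mu) /
                 inf (mass mu @` mass_support mu))).

Definition independent_RVs d d' (T : measurableType d) (T' : measurableType d')
    (R : realType) (P : probability T R) (I : choiceType)
    (X : I -> {RV P >-> T'}) : Prop :=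
  forall (J : {fset I}) (A : I -> set T'),
    (forall i, i \in J -> measurable (A i)) ->
    P (\bigcap_(i in [set` J]) (X i @^-1` A i)) =
    (\prod_(i <- J) P (X i @^-1` A i))%E.

Definition iid_with_law d d' (T : measurableType d) (T' : measurableType d')
    (R : realType) (P : probability T R) (I : choiceType)
    (X : I -> {RV P >-> T'}) (mu : probability T' R) : Prop :=
  independent_RVs X /\
  forall i A, measurable A -> distribution P (X i) A = mu A.

Section walk.
Context d (T : measurableType d) (R : realType) (P : probability T R).
Context (p : nat) (a : 'F_p) (b : nat -> {RV P >-> int}).

Fixpoint walk (k : nat) (w : T) : 'F_p :=
  if k is k'.+1 then a * walk k' w + (b k' w)%:~R else 0.

Lemma measurable_walk k : measurable_fun [set: T] (walk k).
Proof.
elim: k => [|k IHk]; first exact: measurable_cst.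
move=> mT Y _; rewrite setTI.
have -> : walk k.+1 @^-1` Y = \bigcup_(z : int)
    ((b k @^-1` [set z]) `&` (walk k @^-1` [set x | Y (a * x + z%:~R)])).
  apply/seteqP; split=> [w Yw|w [z _ [/= bz Yz]]]; first by exists (b k w).
  by rewrite /preimage /= bz.
apply: countable_bigcupT_measurable => // z.
apply: measurableI.
  by rewrite -[X in measurable X]setTI; exact: measurable_funP.
by rewrite -[X in measurable X]setTI; exact: IHk.
Qed.

HB.instance Definition _ k :=
  isMeasurableFun.Build _ _ _ _ (walk k) (measurable_walk k).

Definition walk_law (n : nat) : probability 'F_p R := distribution P (walk n).

End walk.

Section uniform.
Context (R : realType) (p : nat).

Definition uniform_Fp : set 'F_p -> \bar R :=
  mscale ((#|'F_p|%:R : R)^-1)%:nng (@counting 'F_p R).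

HB.instance Definition _ := Measure.on uniform_Fp.

Lemma uniform_FpT : uniform_Fp [set: 'F_p] = 1%E.
Proof.
have ctT : counting [set: 'F_p] = (#|'F_p|%:R : R)%:E.
  rewrite /counting asboolT; last exact: finite_finset.
  rewrite (_ : fset_set _ = [fset x in 'F_p]%fset) ?card_finset//.
  by apply/fsetP => x; rewrite in_fset_set ?in_setT ?inE//; exact: finite_finset.
rewrite /uniform_Fp /mscale /= [X in (_ * X)%E]ctT -EFinM mulVf // pnatr_eq0 card_ord.
by [].
Qed.

HB.instance Definition _ :=
  Measure_isProbability.Build _ _ _ uniform_Fp uniform_FpT.

End uniform.
Arguments uniform_Fp R p : clear implicits.

Definition TV_dist d (T : measurableType d) (R : realType)
    (pi1 pi2 : probability T R) : \bar R :=
  ereal_sup [set `|pi1 A - pi2 A|%E | A in measurable].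

(* Main.v *)
Require Import Defs.
From HB Require Import structures.
From mathcomp Require Import all_boot all_order all_algebra.
From mathcomp Require Import finmap ring lra.
From mathcomp Require Import all_classical all_reals all_analysis.

Set Implicit Arguments.
Unset Strict Implicit.
Unset Printing Implicit Defensive.

Import Order.TTheory GRing.Theory Num.Theory.
Import numFieldNormedType.Exports.

Local Open Scope classical_set_scope.
Local Open Scope ring_scope.

(** Write [s = sqrt (ln p)], [t = theta * (s - theta)] and [H] for the entropy.
Call a word [z] of [n] increments typical if its probability is at least
[exp (- (n H + t))].  There are at most [exp (n H + t) <= p * exp (- theta^2)]
typical words, so their endpoints form a set of uniform measure at most
[exp (- theta^2)].  The walk ends in that set unless its increments are
atypical, that is, unless the sum of the independent surprisals
[- ln (mu (b_i))], which take values in an interval of length at most [Cmu],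
exceeds its mean [n H] by more than [t]; Hoeffding's inequality bounds the
probability of this event. *)

(** * Hoeffding's lemma and its consequence for product measures *)

Lemma is_derive_ext (R : realType) (f g : R -> R) (x df dg : R) :
  is_derive x (1 : R) f df -> f =1 g -> df = dg -> is_derive x (1 : R) g dg.
Proof. by move=> fdf /funext <- <-. Qed.

Lemma derive_ge0_le (R : realType) (f df : R -> R) (x : R) :
  (forall y, is_derive y (1 : R) f (df y)) -> (forall y, 0 <= y -> 0 <= df y) ->
  0 <= x -> f 0 <= f x.
Proof.
move=> fdf df_ge0 x0; rewrite -subr_ge0.
have [|c /itvP cx ->] := @MVT_segment _ f df _ _ x0 (fun y _ => fdf y).
  apply: continuous_subspaceT => y.
  by apply/differentiable_continuous/derivable1_diffP; case: (fdf y).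
by rewrite mulr_ge0 ?subr_ge0 // df_ge0 // cx.
Qed.

Lemma bernoulli_mgf_le (R : realType) (q h : R) : 0 <= q <= 1 -> 0 <= h ->
  1 - q + q * expR h <= expR (q * h + h ^+ 2 / 8).
Proof.
move=> /andP[q0 q1] h0.
pose D (x : R) : R := 1 - q + q * expR x.
have D_gt0 x : 0 < D x.
  rewrite /D; have := expR_gt0 x; have [->|q_neq0] := eqVneq q 0; first by lra.
  have q_gt0 : 0 < q by rewrite lt_neqAle eq_sym q_neq0.
  by move=> ex; have := mulr_gt0 q_gt0 ex; lra.
have dqe (x : R) : is_derive x (1 : R) (fun y => q * expR y) (q * expR x).
  by apply: is_deriveZ.
have dD (x : R) : is_derive x (1 : R) D (q * expR x).
  by rewrite -[X in is_derive _ _ _ X]add0r; apply: is_deriveD.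
have dlin (c x : R) : is_derive x (1 : R) (fun y => c * y) c.
  apply: (is_derive_ext (is_deriveZ c (is_derive_id x (1 : R)))) => //.
  exact: mulr1.
(* [r] is the tilted parameter; [h^2/8 + q h - ln D] has second derivative
   [1/4 - r (1 - r) >= 0] and vanishes to first order at [0]. *)
pose r (x : R) : R := q * expR x / D x.
have dr (x : R) : is_derive x (1 : R) r (r x * (1 - r x)).
  have dV := is_deriveV (lt0r_neq0 (D_gt0 x)) (dD x).
  apply: (is_derive_ext (is_deriveM (dqe x) dV)) => //.
  rewrite /GRing.scale /= /r; have := lt0r_neq0 (D_gt0 x).
  set d := D x; set e := q * expR x => d0.
  by field.
have g1_ge0 x : 0 <= x -> 0 <= 4^-1 * x + (q - r x).
  move=> x0.
  have r0 : r 0 = q by rewrite /r /D expR0 !mulr1 subrK divr1.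
  have := @derive_ge0_le _ (fun y => 4^-1 * y + (q - r y))
    (fun y => 4^-1 + (0 - r y * (1 - r y))) x.
  rewrite r0 mulr0 subrr addr0; apply => // y _.
  (* Here [1/4 - r (1 - r) = (r - 1/2)^2]. *)
  by have := sqr_ge0 (r y - 1 / 2); rewrite expr2; lra.
have dsq (x : R) : is_derive x (1 : R) (fun y => y * y / 8) (4^-1 * x).
  apply: (is_derive_ext (is_deriveM (is_derive_id x (1:R)) (dlin 8^-1 x))).
    by move=> y; rewrite [LHS]/GRing.mul /=; ring.
  by rewrite /GRing.scale /=; field.
have dln (x : R) : is_derive x (1 : R) (fun y => ln (D y)) (r x).
  apply: (is_derive_ext (is_derive1_comp (is_derive1_ln (D_gt0 x)) (dD x))) => //.
  exact: mulrC.
rewrite -[X in X <= _]lnK ?posrE ?D_gt0 // ler_expR -subr_ge0.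
have := @derive_ge0_le _ (fun h : R => h * h / 8 + (q * h - ln (D h)))
  (fun x => 4^-1 * x + (q - r x)) h.
have -> : D 0 = 1 by rewrite /D expR0 mulr1 subrK.
rewrite ln1 !mulr0 mul0r subrr addr0 /D => hh.
rewrite addrAC addrC expr2; exact: hh.
Qed.

Lemma expR_chord_le (R : realType) (w h : R) : 0 <= w <= 1 ->
  expR (w * h) <= 1 - w + w * expR h.
Proof.
move=> /andP[w0 w1].
have := convex_expR (Itv01 w0 w1) h 0.
by rewrite !convRE /= expR0 mulr0 addr0 mulr1 addrC.
Qed.

(** Hoeffding's lemma. Once [Y] is rescaled to [w] with values in [[0, 1]], convexity replaces each
    exponential by its chord; the average of the chords is the moment generating function of a
    Bernoulli variable whose parameter [q] is the mean of [w]. *)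
Lemma hoeffding_mgf_le (R : realType) (J : finType) (m Y : J -> R) (A C l : R) :
  (forall j, 0 <= m j) -> \sum_j m j = 1 -> 0 < C -> 0 <= l ->
  (forall j, A <= Y j <= A + C) ->
  \sum_j m j * expR (l * (Y j - \sum_k m k * Y k)) <= expR ((l * C) ^+ 2 / 8).
Proof.
move=> m_ge0 m1 C_gt0 l_ge0 AC.
pose w j := (Y j - A) / C.
have w01 j : 0 <= w j <= 1.
  have /andP[AY YC] := AC j.
  by rewrite divr_ge0 ?ler_pdivrMr ?subr_ge0 ?mul1r //= ?lerBlDl // ltW.
pose q := \sum_j m j * w j.
have q01 : 0 <= q <= 1.
  apply/andP; split.
    by apply: sumr_ge0 => j _; rewrite mulr_ge0 //; case/andP: (w01 j).
  by rewrite -m1; apply: ler_sum => j _; rewrite ler_piMr //; case/andP: (w01 j).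
have qE : \sum_k m k * Y k = A + C * q.
  rewrite /q mulr_sumr -[A]mulr1 -m1 mulr_sumr -big_split /=.
  by apply: eq_bigr => j _; rewrite /w; field; rewrite gt_eqF.
apply: (@le_trans _ _ (\sum_j m j *
    (expR (- (q * (l * C))) * (1 - w j + w j * expR (l * C))))).
  apply: ler_sum => j _; apply: ler_wpM2l => //.
  have -> : l * (Y j - \sum_k m k * Y k) = - (q * (l * C)) + w j * (l * C).
    by rewrite qE /w; field; rewrite gt_eqF.
  by rewrite expRD ler_wpM2l ?expR_ge0 // expR_chord_le.
have -> : \sum_j m j * (expR (- (q * (l * C))) * (1 - w j + w j * expR (l * C)))
    = expR (- (q * (l * C))) * (1 - q + q * expR (l * C)).
  rewrite [RHS]mulrDr mulrBr mulr1 -[X in X - _]mulr1 -[X in _ * X - _]m1 /q.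
  rewrite !mulr_suml !mulr_sumr -sumrB -big_split /=.
  by apply: eq_bigr => j _; ring.
have lC : 0 <= l * C by rewrite mulr_ge0 // ltW.
rewrite -[(l * C) ^+ 2 / 8](addKr (q * (l * C))) [leRHS]expRD.
by rewrite ler_wpM2l ?expR_ge0 // bernoulli_mgf_le.
Qed.

(** The mass estimate is a Chernoff bound with free parameter [l]. The cardinality estimate holds
    because each typical word has mass at least [exp (- (n H + t))] while these masses sum to at
    most 1. *)
Lemma product_typical (R : realType) (J : finType) (m : J -> R) (A C t l : R)
    (n : nat) (H := \sum_j m j * ln (m j)^-1)
    (typ := fun z : {ffun 'I_n -> J} =>
       expR (- (n%:R * H + t)) <= \prod_i m (z i)) :
  (forall j, 0 < m j) -> \sum_j m j = 1 -> 0 < C -> 0 <= l ->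
  (forall j, A <= ln (m j)^-1 <= A + C) ->
  1 - expR (n%:R * (l * C) ^+ 2 / 8 - l * t) <=
    \sum_(z | typ z) \prod_i m (z i) /\
  #|typ|%:R <= expR (n%:R * H + t).
Proof.
move=> m_gt0 m1 C_gt0 l_ge0 AC.
have prod_sum (f : J -> R) :
    \sum_(z : {ffun 'I_n -> J}) \prod_i f (z i) = (\sum_j f j) ^+ n.
  by rewrite -(bigA_distr_bigA (fun=> f)) prodr_const card_ord.
have prod_gt0 (z : {ffun 'I_n -> J}) : 0 < \prod_i m (z i) by exact: prodr_gt0.
have tot1 : \sum_(z : {ffun 'I_n -> J}) \prod_i m (z i) = 1.
  by rewrite prod_sum m1 expr1n.
rewrite (bigID typ) /= in tot1.
have ge0 (Q : pred {ffun 'I_n -> J}) : 0 <= \sum_(z | Q z) \prod_i m (z i).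
  by apply: sumr_ge0 => z _; exact: ltW.
split; last first.
  have : \sum_(z | typ z) expR (- (n%:R * H + t)) <= 1.
    rewrite -[leRHS]tot1; apply: (@le_trans _ _ (\sum_(z | typ z) \prod_i m (z i))).
      exact: ler_sum.
    by rewrite lerDl.
  rewrite sumr_const [X in X *+ _]expRN -[leLHS]mulr_natl ler_pdivrMr ?expR_gt0 // mul1r.
  by apply: le_trans; rewrite ler_nat.
rewrite -[X in X - _]tot1 lerBlDl [leLHS]addrC lerD2r.
pose F j := m j * expR (l * (ln (m j)^-1 - H)).
have F_ge0 j : 0 <= F j by rewrite mulr_ge0 ?expR_ge0 // ltW.
(* On an atypical word the surprisals sum to at least [n H + t], so the weight
   [exp (l * (sum - n H) - l t)] is at least 1. *)
apply: (@le_trans _ _ (\sum_(z | ~~ typ z) expR (- (l * t)) * \prod_i F (z i))).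
  apply: ler_sum => z; rewrite /typ -ltNge => z_atyp.
  rewrite big_split /= -expR_sum mulrCA ler_peMr //; first exact: ltW.
  rewrite -expRD -[X in X <= _]expR0 ler_expR -mulr_sumr sumrB sumr_const.
  rewrite card_ord -mulr_natl -mulrN -mulrDr mulr_ge0 //.
  suff : n%:R * H + t <= \sum_i ln (m (z i))^-1 by lra.
  rewrite -ler_expR expR_sum (eq_bigr (fun i => (m (z i))^-1)); last first.
    by move=> i _; rewrite lnK // posrE invr_gt0.
  rewrite prodfV -[X in X <= _]invrK lef_pV2 ?posrE ?invr_gt0 ?expR_gt0 //.
  by rewrite -expRN ltW.
rewrite -mulr_sumr expRD [leRHS]mulrC ler_pM2l ?expR_gt0 //.
(* Adding the nonnegative terms of the typical words turns the sum into an [n]-th power, whose base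
   is bounded by Hoeffding's lemma. *)
apply: (@le_trans _ _ (\sum_(z : {ffun 'I_n -> J}) \prod_i F (z i))).
  rewrite [leRHS](bigID typ) /= lerDr; apply: sumr_ge0 => z _.
  exact: prodr_ge0.
rewrite prod_sum -mulrA expRM_natl lerXn2r ?nnegrE ?expR_ge0 //.
  exact: sumr_ge0.
by apply: hoeffding_mgf_le => // j; exact: ltW.
Qed.

(** * Masses, entropy and surprisal of a finitely supported law *)

Section mass.
Context (R : realType) (mu : probability int R).

Lemma massE z : mu [set z] = (mass mu z)%:E.
Proof. by rewrite /mass fineK // fin_num_measure. Qed.

Lemma mass_ge0 z : 0 <= mass mu z.
Proof. exact: fine_ge0. Qed.

Lemma mass_le1 z : mass mu z <= 1.
Proof. by rewrite -lee_fin -massE probability_le1. Qed.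

Context (mu_fin : finite_set (mass_support mu)).

Lemma sum_mass_support : \sum_(z <- fset_set (mass_support mu)) mass mu z = 1.
Proof.
(* The complement of the support is a countable union of null sets: [N k] is the massless point with
   code [k] if there is one, and empty otherwise. *)
have null_out : mu (~` mass_support mu) = 0%E.
  apply/measure_negligible => //.
  pose N k := if choice.unpickle k : option int is Some z then
    (if mass mu z == 0 then [set z] else set0) else set0.
  have -> : ~` mass_support mu = \bigcup_k N k.
    apply/seteqP; split=> [z /= /negP|z [k _]].
      rewrite negbK => z0; exists (choice.pickle z) => //.
      by rewrite /N choice.pickleK z0.
    rewrite /N; case: choice.unpickle => // y.
    by case: ifP => // y0 -> /=; rewrite /mass_support /= y0.
  apply: negligible_bigcup => k; apply/negligibleP => //.
  rewrite /N; case: choice.unpickle => [z|]; last exact: measure0.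
  case: ifPn => [/eqP z0|_].   by have := massE z; rewrite z0.
  exact: measure0.
apply: EFin_inj; rewrite -sumEFin.
under eq_bigr do rewrite -massE.
rewrite -fsbig_finite //= -measure_fin_bigcup //; last first.
  by move=> i j _ _ [x [/= <- <-]].
rewrite bigcup_imset1 image_id -(probability_setT mu) -(setUv (mass_support mu)).
rewrite measureU //; last by rewrite setICr.
by rewrite [X in (_ + X)%E]null_out adde0.
Qed.

Lemma entropyE : entropy mu =
  \sum_(z <- fset_set (mass_support mu)) mass mu z * ln (mass mu z)^-1.
Proof.
rewrite /entropy -fsbig_finite //; apply/esym/fsbig_widen => // z [_ /= /negP].
by rewrite negbK => /eqP ->; rewrite mul0r.
Qed.

Lemma entropy_ge0 : 0 <= entropy mu.
Proof.
rewrite entropyE; apply: sumr_ge0 => z _; have [->|z0] := eqVneq (mass mu z) 0.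
  by rewrite mul0r.
have m_gt0 : 0 < mass mu z by rewrite lt0r z0 mass_ge0.
by rewrite mulr_ge0 ?mass_ge0 // ln_ge0 // invf_ge1 ?mass_le1.
Qed.

Lemma Cmu_ge1 : 1 <= Cmu mu.
Proof. by rewrite /Cmu le_max lexx. Qed.

(** The surprisal lies between [- ln sup] and [- ln inf] of the masses, and the gap [ln (sup / inf)]
    is at most [Cmu]. Finiteness of the support makes the infimum positive. *)
Lemma surprisal_range z (A := - ln (sup (mass mu @` mass_support mu))) :
  mass_support mu z -> A <= ln (mass mu z)^-1 <= A + Cmu mu.
Proof.
rewrite /A => zmu.
set E := mass mu @` mass_support mu.
have Ez : E (mass mu z) by exists z.
have m_gt0 y : mass_support mu y -> 0 < mass mu y.
  by move=> y0; rewrite lt0r mass_ge0 andbT.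
have supE : mass mu z <= sup E.
  by apply: ub_le_sup => //; exists 1 => _ [y _ <-]; exact: mass_le1.
have infE : inf E <= mass mu z.
  by apply: ge_inf => //; exists 0 => _ [y _ <-]; exact: mass_ge0.
have sup_gt0 : 0 < sup E := lt_le_trans (m_gt0 _ zmu) supE.
(* Masses are at most 1, so their product is a positive lower bound. *)
have inf_gt0 : 0 < inf E.
  have prod_gt0 : 0 < \prod_(y <- fset_set (mass_support mu)) mass mu y.
    rewrite big_seq; apply: prodr_gt0 => y.
    by rewrite in_fset_set // inE => /m_gt0.
  apply: (lt_le_trans prod_gt0); apply: lb_le_inf; first by exists (mass mu z).
  move=> _ [y ymu <-]; have yS : y \in fset_set (mass_support mu).
    by rewrite in_fset_set // inE.
  rewrite (big_rem y) //= ler_piMr ?mass_ge0 //.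
  by apply: Num.Theory.prodr_ile1 => x _; rewrite mass_ge0 mass_le1.
rewrite lnV ?posrE ?m_gt0 // lerN2 ler_ln ?posrE ?m_gt0 // supE /=.
apply: (@le_trans _ _ (- ln (inf E))).
  by rewrite lerN2 ler_ln ?posrE ?m_gt0.
rewrite -lerBlDl; apply: (@le_trans _ _ (ln (sup E / inf E))); last first.
  by rewrite /Cmu le_max lexx orbT.
by rewrite ln_div ?posrE // opprK addrC.
Qed.

End mass.

(** * From words of increments to the law of the walk *)

Section walk_lower_bound.
Context d (T : measurableType d) (R : realType) (P : probability T R).
Context (mu : probability int R) (p : nat) (a : 'F_p).
Context (b : nat -> {RV P >-> int}) (b_iid : iid_with_law b mu).

Fixpoint affine_orbit (c : nat -> int) (k : nat) : 'F_p :=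
  if k is k'.+1 then a * affine_orbit c k' + (c k')%:~R else 0.

Lemma walk_affine_orbit (c : nat -> int) n w :
  (forall i, (i < n)%N -> b i w = c i) -> walk a b n w = affine_orbit c n.
Proof.
elim: n => [//|n IHn] bc /=; rewrite bc // IHn // => i i_n.
by apply: bc; exact: ltnW.
Qed.

Lemma measurable_cylinder (J : {fset nat}) (c : nat -> int) :
  measurable (\bigcap_(i in [set` J]) b i @^-1` [set c i]).
Proof.
apply: fin_bigcap_measurable => // i _.
by rewrite -[X in measurable X]setTI; exact: measurable_funP.
Qed.

(** Independence is stated over finite sets of indices, hence the encoding of the first [n] times as
    a finite set. *)
Lemma cylinder_prob (n : nat) (c : nat -> int) :
  P (\bigcap_(i in [set` seq_fset tt (iota 0 n)]) b i @^-1` [set c i]) =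
  (\prod_(i < n) mass mu (c i))%:E.
Proof.
have [indep law] := b_iid.
rewrite (indep _ (fun i => [set c i])) //.
have lawE i : P (b i @^-1` [set c i]) = (mass mu (c i))%:E.
  by rewrite -massE -(law i).
under eq_bigr do rewrite lawE.
rewrite prodEFin; congr EFin.
rewrite (perm_big (iota 0 n)); last first.
  by rewrite uniq_perm ?fset_uniq ?iota_uniq // => i; rewrite seq_fsetE.
by rewrite -[X in iota 0 X]subn0 big_mkord.
Qed.

(** The cylinders of distinct words are disjoint because [v] is injective, and on each of them the
    walk follows [affine_orbit]. Only an inequality holds in general, since words outside [S] may
    reach the same endpoints. [ext] pads a word with 0 to a sequence indexed by [nat]. *)
Lemma walk_law_ge (J : finType) (v : J -> int) (n : nat)
    (S : {set {ffun 'I_n -> J}})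
    (ext := fun (z : {ffun 'I_n -> J}) (i : nat) =>
       if insub i is Some j then v (z j) else 0) :
  injective v ->
  ((\sum_(z in S) \prod_(i < n) mass mu (v (z i)))%:E <=
   walk_law a b n
     [set` [set affine_orbit (ext z) n | z in S]%SET])%E.
Proof.
move=> v_inj.
have extE z (i : 'I_n) : ext z i = v (z i) by rewrite /ext valK.
pose K := seq_fset tt (iota 0 n).
have inK i : (i \in K) = (i < n)%N by rewrite seq_fsetE mem_iota.
pose cyl z := \bigcap_(i in [set` K]) b i @^-1` [set ext z i].
have cylE z w : cyl z w <-> forall i : 'I_n, b i w = v (z i).
  split=> [cw i|cw i /=].
    by rewrite -extE; apply: cw; rewrite /= inK.
  rewrite inK => i_n.
  by rewrite (cw (Ordinal i_n)) -extE.
have -> : (\sum_(z in S) \prod_(i < n) mass mu (v (z i)))%:E =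
    P (\bigcup_(z in [set` S]) cyl z).
  rewrite measure_fin_bigcup //; last 2 first.
  - move=> z1 z2 _ _ [w [/cylE w1 /cylE w2]].
    by apply/ffunP => i; apply: v_inj; rewrite -w1 -w2.
  - by move=> z _; exact: measurable_cylinder.
  rewrite (fsbigE (enum S)) ?enum_uniq //; last 2 first.
  - by move=> z /=; rewrite mem_enum.
  - by move=> z /= zS; rewrite mem_enum zS.
  rewrite -sumEFin big_enum_cond /=.
  apply: eq_big => [z|z _]; first by rewrite mem_setE andbb.
  rewrite cylinder_prob; congr EFin.
  by apply: eq_bigr => i _; rewrite extE.
apply: le_measure; rewrite ?inE //.
- by apply: fin_bigcup_measurable => // z _; exact: measurable_cylinder.
- by rewrite -[X in measurable X]setTI; exact: measurable_walk.
move=> w [z /= zS /cylE zw] /=; apply/imsetP; exists z => //.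
apply: walk_affine_orbit => i i_n.
by rewrite (zw (Ordinal i_n)) -extE.
Qed.

End walk_lower_bound.

(** * Uniform measure, choice of the parameter and conclusion *)

Lemma uniform_FpE (R : realType) (p : nat) (B : {set 'F_p}) : prime p ->
  uniform_Fp R p [set` B] = (#|B|%:R / p%:R)%:E.
Proof.
move=> p_prime; rewrite /uniform_Fp /mscale /=.
have -> : counting [set` B] = (#|B|%:R : R)%:E.
  rewrite /counting asboolT; last exact: finite_finset.
  rewrite (_ : fset_set _ = [fset x in B]%fset) ?card_finset//.
  apply/fsetP => x; rewrite in_fset_set; last exact: finite_finset.
  by rewrite mem_setE inE.
by rewrite -EFinM mulrC card_Fp.
Qed.

(* [l] minimizes the left-hand side when [N = s * (s - theta) / H]. *)
Lemma deviation_exponent_le (R : realFieldType) (N H C s theta : R)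
    (t := theta * (s - theta)) (l := 4 * theta * H / (s * C ^+ 2)) :
  0 <= H -> 0 < C -> 0 < theta -> theta < s / 2 -> N * H <= s * (s - theta) ->
  N * (l * C) ^+ 2 / 8 - l * t <= - (H / C ^+ 2 * theta ^+ 2).
Proof.
move=> H0 C0 th0 ths NH.
have s0 : 0 < s by lra.
pose k := H * theta ^+ 2 / (C ^+ 2 * s ^+ 2).
have k0 : 0 <= k.
  by rewrite divr_ge0 ?mulr_ge0 ?exprn_ge0 // ltW.
have -> : N * (l * C) ^+ 2 / 8 - l * t =
    k * (2 * (N * H) - 4 * (s * (s - theta))).
  by rewrite /k /l /t; field; rewrite !gt_eqF.
have -> : - (H / C ^+ 2 * theta ^+ 2) = k * (- s ^+ 2).
  by rewrite /k; field; rewrite !gt_eqF.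
(* It remains to see that [2 N H - 4 s (s - theta) <= - s^2]; the bound on [N H] reduces this to
   [2 s theta <= s^2]. *)
apply: ler_wpM2l => //.
have : s * theta <= s * (s / 2) by rewrite ler_pM2l // ltW.
by rewrite mulrBr in NH *; rewrite expr2; lra.
Qed.

Theorem mainTheorem4 (R : realType) (mu : probability int R)
    (mu_fin : finite_set (mass_support mu))
    (mu_ge2 : (2 <= #|` fset_set (mass_support mu)|)%N)
    (d : measure_display) (T : measurableType d) (P : probability T R)
    (b : nat -> {RV P >-> int}) (b_iid : iid_with_law b mu)
    (p : nat) (p_prime : prime p) (a : 'F_p)
    (theta : R) (theta_gt0 : 0 < theta)
    (theta_lt : theta < Num.sqrt (ln p%:R) / 2)
    (n : nat)
    (n_def : Num.floor ((ln p%:R - theta * Num.sqrt (ln p%:R)) / entropy mu)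
             = n%:Z) :
  ((1 - expR (- (theta ^+ 2))
      - 2 * expR (- (entropy mu / Cmu mu ^+ 2 * theta ^+ 2)))%:E
   <= TV_dist (walk_law a b n) (uniform_Fp R p))%E.
Proof.
set s := Num.sqrt (ln p%:R) in theta_lt n_def; set H := entropy mu in n_def *.
set C := Cmu mu.
have p_gt0 : 0 < p%:R :> R by rewrite ltr0n prime_gt0.
have sL : ln p%:R = s ^+ 2 :> R.
  by rewrite sqr_sqrtr // ln_ge0 // ler1n prime_gt0.
have H_ge0 : 0 <= H by exact: entropy_ge0.
have C_gt0 : 0 < C by apply: lt_le_trans (Cmu_ge1 mu).
have s_gt0 : 0 < s by lra.
have TV_ge A : ((walk_law a b n A - uniform_Fp R p A)%E <=
    TV_dist (walk_law a b n) (uniform_Fp R p))%E.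
  apply: (@le_trans _ _ `|walk_law a b n A - uniform_Fp R p A|%E).
    exact: lee_abs.
  by apply: ereal_sup_ubound; exists A.
(* If [H = 0], the claimed bound is [- 1 - exp (- theta^2) < 0] and the empty set suffices as test
   set. *)
have [H0|H_neq0] := eqVneq H 0.
  apply: le_trans (TV_ge set0); rewrite !measure0 sube0 lee_fin.
  rewrite H0 mul0r mul0r oppr0 expR0.
  by have := expR_gt0 (- theta ^+ 2); lra.
have H_gt0 : 0 < H by rewrite lt0r H_neq0.
have nH : n%:R * H <= s * (s - theta).
  have := floor_le ((ln p%:R - theta * s) / H).
  by rewrite n_def ler_pdivlMr // sL expr2 mulrBr [theta * s]mulrC.
(* Words are taken over the support seen as a finite type, on which all masses are positive. *)
pose J : finType := fset_set (mass_support mu).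
pose v (j : J) : int := fsval j.
have v_supp (j : J) : mass_support mu (v j).
  by have := valP j; rewrite in_fset_set // inE.
have m_gt0 (j : J) : 0 < mass mu (v j).
  by rewrite lt0r mass_ge0 andbT; exact: v_supp.
have sum_J (f : int -> R) :
    \sum_(j : J) f (v j) = \sum_(z <- fset_set (mass_support mu)) f z.
  by rewrite big_seq_fsetE.
have HE : \sum_(j : J) mass mu (v j) * ln (mass mu (v j))^-1 = H.
  by rewrite (sum_J (fun z => mass mu z * ln (mass mu z)^-1)) /H entropyE.
pose t := theta * (s - theta); pose l := 4 * theta * H / (s * C ^+ 2).
have l_ge0 : 0 <= l by rewrite divr_ge0 ?mulr_ge0 ?exprn_ge0 // ltW.
have m1 : \sum_(j : J) mass mu (v j) = 1.
  by rewrite (sum_J (mass mu)) sum_mass_support.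
have [mass_typ card_typ] := product_typical t n m_gt0 m1 C_gt0 l_ge0
  (fun j => surprisal_range mu_fin (v_supp j)).
rewrite HE in mass_typ card_typ.
set typ := (X in \sum_(z | X z) _) in mass_typ; set S := [set z | typ z]%SET.
have := walk_law_ge a b_iid S val_inj.
set B := imset _ _ => walkB.
apply: le_trans (TV_ge [set` B]).
rewrite uniform_FpE //.
apply: le_trans (leeB walkB (lexx _)).
rewrite -EFinB lee_fin.
(* By [nH], [n H + t <= (s + theta) (s - theta) = ln p - theta^2]; this is what fixes the choice of
   [t]. *)
have cardB : #|B|%:R / p%:R <= expR (- theta ^+ 2).
  rewrite ler_pdivrMr // -[p%:R]lnK ?posrE // -expRD.
  apply: (@le_trans _ _ #|S|%:R); first by rewrite ler_nat leq_imset_card.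
  rewrite cardsE; apply: (le_trans card_typ); rewrite ler_expR sL.
  by move: nH; rewrite /t !expr2; lra.
have mass_S : 1 - expR (- (H / C ^+ 2 * theta ^+ 2)) <=
    \sum_(z in S) \prod_(i < n) mass mu (v (z i)).
  rewrite (eq_bigl typ) => [|z]; last by rewrite inE.
  apply: le_trans mass_typ; rewrite lerD2l lerN2 ler_expR.
  exact: deviation_exponent_le.
(* The two estimates give the bound with coefficient 1 on the last exponential; nonnegativity of the
   latter gives it with 2. *)
have := expR_ge0 (- (H / C ^+ 2 * theta ^+ 2)).
by lra.
Qed.
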